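(* Let $\mathbb{F}$ be a field of characteristic $0$ and $A=A_h$ with $h=\mathsf{u}_1^{\alpha_1}\cdots\mathsf{u}_t^{\alpha_t}$ as in the context, where $\alpha_1,\dots,\alpha_k\geq2$, $\alpha_{k+1}=\dots=\alpha_t=1$, and assume $k\geq1$; let $m_h=\max\{\alpha_j-1:1\leq j\leq k\}$. Then the $\mathrm{HH}^1(A)$-Lie module $\mathrm{HH}^2(A)$ (Gerstenhaber bracket) satisfies: (a) $\mathrm{HH}^2(A)=P_0\supsetneq P_1\supsetneq\cdots\supsetneq P_{m_h-1}\supsetneq P_{m_h}=0$ is a filtration of length $m_h$ by $\mathrm{HH}^1(A)$-submodules. (b) For each $0\leq i\leq m_h-1$, the factor $S_i=P_i/P_{i+1}$ is completely reducible with decomposition $S_i=\bigoplus_{\alpha_j\geq i+2}\overline{V}_{ij}$, where: (i) $\mathsf{Z}(\mathrm{HH}^1(A))\oplus\mathcal{N}$ acts trivially on $S_i$, so $S_i$ is a module over $(\overline{\mathsf{D}}_1\otimes\mathsf{W})\oplus\cdots\oplus(\overline{\mathsf{D}}_k\otimes\mathsf{W})$; (ii) $\overline{V}_{ij}\cong\overline{\mathsf{D}}_j\otimes V_{\mu_{ij}}$ with $\mu_{ij}=\frac{\alpha_j-i}{\alpha_j-1}$, and this is irreducible; (iii) $\overline{\mathsf{D}}_q\otimes\mathsf{W}$ acts trivially on $\overline{V}_{ij}$ for $q\neq j$, and $\overline{\mathsf{D}}_j\otimes\mathsf{W}$ acts on $\overline{V}_{ij}=\overline{\mathsf{D}}_j[\hat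 y]$ by $(g\bar e_j\otimes w_m).(f\bar e_j\hat y^\ell)=fg\bar e_j\,(\ell-(m+1)\mu_{ij})\hat y^{m+\ell}$; (iv) $\overline{V}_{ij}\cong\overline{V}_{i'j'}$ as $\mathrm{HH}^1(A)$-modules iff $(i,j)=(i',j')$. (c) $\mathrm{HH}^2(A)$ has finite composition length $\sum_{j=1}^k(\alpha_j-1)$ (the number of irreducible factors of $\gcd(h,h')$ counted with multiplicity), with composition factors $\{\overline{V}_{ij}:0\leq i\leq m_h-1,\ \alpha_j\geq i+2\}$, pairwise non-isomorphic. (d) $\mathrm{HH}^2(A)$ is a semisimple $\mathrm{HH}^1(A)$-module iff $m_h\leq1$, i.e. iff $h$ is not divisible by the cube of any non-constant polynomial.
   Context: $A=A_h$ is the unital subalgebra of the Weyl algebra $A_1=\mathbb{F}\langle x,y\mid yx-xy=1\rangle$ generated by $x$ and $\hat y=yh$, where $h=\mathsf{u}_1^{\alpha_1}\cdots\mathsf{u}_t^{\alpha_t}$ with $\mathsf{u}_i$ distinct monic irreducible polynomials. $\pi_h=\mathsf{u}_1\cdots\mathsf{u}_t$, $\gcd(h,h')=\mathsf{u}_1^{\alpha_1-1}\cdots\mathsf{u}_k^{\alpha_k-1}$. $a_n=\pi_hh^{n-1}y^n$ ($n\geq1$), $a_0=\pi_h/h$; for $g\in\mathbb{F}[x]$, $\mathrm{ad}_{ga_n}=[ga_n,-]$ is a derivation of $A$. $\delta_0(g)=(g\pi_h)'-g\pi_hh'/h$. $\mathrm{HH}^2(A)$ is identified with $\mathsf{D}[\hat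 y]$, $\mathsf{D}=\mathbb{F}[x]/\gcd(h,h')\mathbb{F}[x]$, via the standard minimal resolution (the class of $a\in A$ modulo $\gcd(h,h')A$ corresponds to the 2-cocycle with value $a$ on the generator), and in this identification the center of $\mathrm{HH}^1(A)$ acts by $0$ and $[\mathrm{ad}_{ga_n},p\hat y^k]=(n\pi_hgp'-ng\frac{\pi_hh'}{h}p-k\delta_0(g)p)\hat y^{n+k-1}$. It is known (earlier work) that $\mathrm{HH}^1(A)=\mathsf{Z}(\mathrm{HH}^1(A))\oplus[\mathrm{HH}^1(A),\mathrm{HH}^1(A)]$, that $\mathcal{N}=\mathrm{span}\{\mathrm{ad}_{ga_n}:g\in\mathsf{u}_1\cdots\mathsf{u}_k\mathbb{F}[x],n\geq0\}$ is the maximal nilpotent ideal of $[\mathrm{HH}^1(A),\mathrm{HH}^1(A)]$. $\Theta_i=\prod_{j=1}^k\mathsf{u}_j^{\min\{\alpha_j-1,i\}}$ and $P_i=\Theta_i\mathsf{D}[\hat y]$. Let $e_1,\dots,e_k\in\mathsf{D}$ be orthogonal idempotents summing to $1$ with $\mathsf{D}e_j\cong\mathbb{F}[x]/\mathsf{u}_j^{\alpha_j-1}$; let $\overline{\mathsf{D}}=\mathbb{F}[x]/\mathsf{u}_1\cdots\mathsf{u}_k\mathbb{F}[x]$, $\bar e_j$ the image of $e_j$, and $\overline{\mathsf{D}}_j=\overline{\mathsf{D}}\bar e_j\cong\mathbb{F}[x]/\mathsf{u}_j\mathbb{F}[x]$ (a field). For $0\leq i\leq m_h-1$, $S_i\cong\bigoplus_{\alpha_j\geq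 i+2}\overline{\mathsf{D}}_j[\hat y]$ via $\Theta_if\hat y^\ell+P_{i+1}\mapsto\sum_{\alpha_j\geq i+2}f\bar e_j\hat y^\ell$, and $\overline{V}_{ij}$ denotes the summand $\overline{\mathsf{D}}_j[\hat y]$. $\mathsf{W}=\mathrm{span}_{\mathbb{F}}\{w_m:m\geq-1\}$ with $[w_m,w_n]=(n-m)w_{m+n}$ (Witt algebra). Fix $\nu\in\mathbb{F}[x]$ with $\nu\delta_0(1)\equiv1\pmod{\mathsf{u}_1\cdots\mathsf{u}_k}$; there is a Lie algebra isomorphism $(\overline{\mathsf{D}}_1\otimes\mathsf{W})\oplus\cdots\oplus(\overline{\mathsf{D}}_k\otimes\mathsf{W})\cong[\mathrm{HH}^1(A),\mathrm{HH}^1(A)]/\mathcal{N}$ sending $g\bar e_q\otimes w_m$ to $-\mathrm{ad}_{ge_q\nu a_{m+1}}+\mathcal{N}$ (with $e_q$ lifted to $\mathbb{F}[x]$). For $\mu\in\mathbb{F}$, $V_\mu=\mathbb{F}[\hat y]$ is the $\mathsf{W}$-module with $w_m.\hat y^\ell=(\ell-(m+1)\mu)\hat y^{m+\ell}$; $\overline{\mathsf{D}}_j\otimes V_\mu$ is its scalar extension. *)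

(* Defs.v *)
From HB Require Import structures.
From mathcomp Require Import all_boot all_order all_algebra.
Set Implicit Arguments. Unset Strict Implicit. Unset Printing Implicit Defensive.
Import Order.TTheory GRing.Theory Num.Theory.
Local Open Scope ring_scope.

(* HH^2(A) is identified (context) with D[yhat], D = F[x]/gcd(h,h').
   We represent an element of D[yhat] by a representative in
   {poly {poly F}} : the coefficient of 'X^l (a polynomial in x) is the
   coefficient of yhat^l.  Two representatives define the same element of
   HH^2(A) iff their difference lies in [inK d], d = gcd(h,h').
   Subspaces / submodules of HH^2(A) are represented by their preimages in
   {poly {poly F}} (which contain [inK d]); subquotients W/U of HH^2(A) are
   represented by pairs of such preimages. *)

Section HH.
Variable F : fieldType.

Definition Vset := {poly {poly F}} -> Prop.

Definition hdiv (h pi : {poly F}) : {poly F} := (pi * h^`()) %/ h.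

Definition delta0 (h pi g : {poly F}) : {poly F} := (g * pi)^`() - g * hdiv h pi.

(* action of the class of ad_{g a_n} on HH^2(A) = D[yhat]:
   [ad_{g a_n}, p yhat^l] = (n pi g p' - n g (pi h'/h) p - l delta0(g) p) yhat^(n+l-1) *)
Definition rho (h pi g : {poly F}) (n : nat) (P : {poly {poly F}}) : {poly {poly F}} :=
  \sum_(l < size P)
     ((pi * g * (P`_l)^`()) *+ n - (g * hdiv h pi * P`_l) *+ n
        - (delta0 h pi g * P`_l) *+ l)%:P * 'X^((n + l).-1).

Definition inK (d : {poly F}) : Vset := fun P => forall l, d %| P`_l.

(* T D[yhat] (preimage) *)
Definition divall (T : {poly F}) : Vset := fun P => forall l, T %| P`_l.

Definition vsubset (X Y : Vset) := forall p, X p -> Y p.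

Definition subspace (X : Vset) :=
  X 0 /\ (forall p q, X p -> X q -> X (p + q)) /\
  (forall (c : F) p, X p -> X (c%:P%:P * p)).

(* HH^1(A)-submodule: the center of HH^1(A) acts by 0 and
   [HH^1(A),HH^1(A)] is spanned by the classes of the ad_{g a_n}. *)
Definition submodule (h pi d : {poly F}) (X : Vset) :=
  subspace X /\ (forall p, inK d p -> X p) /\
  (forall g n p, X p -> X (rho h pi g n p)).

Definition irreducible_sq (h pi d : {poly F}) (W U : Vset) :=
  submodule h pi d W /\ submodule h pi d U /\ vsubset U W /\
  (exists w, W w /\ ~ U w) /\
  (forall X, submodule h pi d X -> vsubset U X -> vsubset X W ->
     vsubset X U \/ vsubset W X).

Definition iso_sq (h pi : {poly F}) (W U W' U' : Vset) :=
  exists f : {poly {poly F}} -> {poly {poly F}},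
    (forall p q, f (p + q) = f p + f q) /\
    (forall (c : F) p, f (c%:P%:P * p) = c%:P%:P * f p) /\
    (forall w, W w -> W' (f w)) /\
    (forall w, W w -> (U' (f w) <-> U w)) /\
    (forall w', W' w' -> exists w, W w /\ U' (f w - w')) /\
    (forall g n w, W w -> U' (f (rho h pi g n w) - rho h pi g n (f w))).

Definition composition_series (h pi d : {poly F}) (X : nat -> Vset) (L : nat) :=
  (forall p, X 0%N p) /\ (forall p, X L p <-> inK d p) /\
  (forall r, (r < L)%N -> irreducible_sq h pi d (X r) (X r.+1)).

Definition semisimple (h pi d : {poly F}) :=
  forall p, exists (n : nat) (Xs : nat -> Vset) (xs : nat -> {poly {poly F}}),
    (forall r, (r < n)%N -> irreducible_sq h pi d (Xs r) (inK d) /\ Xs r (xs r)) /\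
    inK d (p - \sum_(r < n) xs r).

Definition Theta (u : nat -> {poly F}) (alpha : nat -> nat) (k i : nat) : {poly F} :=
  \prod_(j < k) u j ^+ minn (alpha j).-1 i.

(* preimage in P_i of the summand Vbar_{ij} of S_i = P_i/P_{i+1}:
   Theta_i e_j D[yhat] + P_{i+1} *)
Definition Wsq (T T1 e : {poly F}) : Vset :=
  fun p => exists q r, divall T1 r /\ p = (T * e)%:P * q + r.

End HH.

(* Main.v *)
(* All the submodules in play are of the form T D[yhat] with T = prod_q u_q^(b_q).
   For z in T F[x], the bracket with ad_{g a_n} sends z yhat^l to
   -(l - n mu) g delta_0(1) z yhat^(n+l-1) modulo T u_j, where
   mu = (alpha_j - b_j) / (alpha_j - 1). So each elementary step T D[yhat] over
   T u_j D[yhat] is the scalar extension to F[x]/u_j of the Witt module V_mu.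
   It is irreducible because a_0 lowers any element to a nonzero one in degree 0,
   whence, as mu <> 0, the a_n recover every degree. It depends only on (j, b_j):
   ad_{g a_n} annihilates it when u_j | g, which detects j, and mu is the
   eigenvalue of ad_{nu a_1} on the kernel of ad_{a_0}. Increasing the exponents one coordinate at a
   time gives a composition series. Finally the ideal N kills every simple
   submodule, but ad_{u_1...u_k a_1} maps 1 to - u_1...u_k pi h'/h, which is nonzero
   in D as soon as some alpha_j >= 3; so semisimplicity forces m_h <= 1. *)
Require Import Defs.
From HB Require Import structures.
From mathcomp Require Import all_boot all_order all_algebra.
From mathcomp Require Import ring zify.
From Stdlib Require Import Classical FunctionalExtensionality PropExtensionality.
Set Implicit Arguments. Unset Strict Implicit. Unset Printing Implicit Defensive.
Import Order.TTheory GRing.Theory Num.Theory.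
Local Open Scope ring_scope.

(** * Coprimality, Chinese remaindering and derivatives in [F[x]] *)

Section PolynomialDivisibility.
Variable F : fieldType.
Implicit Types p q c : {poly F}.

(** The inverse of [q] modulo [p] comes from a Bezout relation. This supplies the polynomials g for
    which ad_{g a_n} sends a given vector to a prescribed one. *)
Lemma coprimep_solve p q c : coprimep p q -> exists g, p %| g * q - c.
Proof.
case/Bezout_eq1_coprimepP=> -[a b] /= ab1; exists (c * b).
apply/dvdpP; exists (- (c * a)).
by rewrite -[X in _ - X]mulr1 -ab1; ring.
Qed.

Lemma coprimep_congr p q c : p %| q - c -> coprimep p c -> coprimep p q.
Proof.
move=> /dvdpP[r /eqP]; rewrite subr_eq => /eqP->.
by rewrite coprimep_addl_mul.
Qed.

Lemma dvdp_mul_sub1 p q c : p %| q - 1 -> p %| c - q * c.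
Proof.
move=> dv; have -> : c - q * c = - ((q - 1) * c) by ring.
by rewrite dvdpNr dvdp_mulr.
Qed.

Lemma dvdp_sum (I : finType) (P : pred I) (f : I -> {poly F}) p :
  (forall i, P i -> p %| f i) -> p %| \sum_(i | P i) f i.
Proof.
by move=> dv; elim/big_ind: _ => // x y; exact: dvdp_add.
Qed.

Lemma coprimep_prodr (I : finType) (P : pred I) (f : I -> {poly F}) p :
  (forall i, P i -> coprimep p (f i)) -> coprimep p (\prod_(i | P i) f i).
Proof.
move=> cop; elim/big_ind: _ => // [|x y cx cy]; first exact: coprimep1.
by rewrite coprimepMr cx.
Qed.

Lemma dvdp_prodP k (f : nat -> {poly F}) c :
  (forall i j, (i < k)%N -> (j < k)%N -> i != j -> coprimep (f i) (f j)) ->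
  (\prod_(i < k) f i %| c) <-> (forall i, (i < k)%N -> f i %| c).
Proof.
elim: k => [|k IHk] cop; first by rewrite big_ord0 dvd1p.
have IH : (\prod_(i < k) f i %| c) <-> (forall i, (i < k)%N -> f i %| c).
  by apply: IHk => i j ik jk; apply: cop; exact: ltnW.
rewrite big_ord_recr /= Gauss_dvdp; last first.
  rewrite coprimep_sym; apply: coprimep_prodr => i _.
  by apply: cop; rewrite ?ltnSn 1?ltnW ?ltnS ?ltn_ord // gtn_eqF.
split=> [/andP[/IH dv dvk] i|dv].
  by rewrite ltnS leq_eqVlt => /predU1P[->|/dv].
apply/andP; split; last exact: dv.
by apply/IH => i ik; apply: dv; exact: ltnW.
Qed.

Lemma monic_irreducible_coprime p q :
    p \is monic -> q \is monic -> irreducible_poly p -> irreducible_poly q ->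
  p != q -> coprimep p q.
Proof.
move=> mp mq irp [_ irq]; rewrite irreducible_poly_coprime //.
apply: contra => dv; case: irp => sp _.
rewrite -eqp_monic //; apply: irq => //.
by apply: contraTneq sp => ->.
Qed.

Hypothesis pchar0 : [pchar F] =i pred0.

Lemma natf_neq0_of_pchar0 n : (0 < n)%N -> n%:R != 0 :> F.
Proof. by move/pcharf0P: pchar0 => ->; rewrite lt0n. Qed.

(** In characteristic 0 the leading coefficient of p' is deg(p) times that of p, so p' is nonzero of
    smaller degree and p cannot divide it. *)
Lemma irreducible_coprime_deriv p : irreducible_poly p -> coprimep p p^`().
Proof.
move=> irr; have [sp _] := irr; have p0 : p != 0.
  by apply: contraTneq sp => ->; rewrite size_poly0.
rewrite irreducible_poly_coprime //; apply/negP => dv.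
suff dp0 : p^`() != 0.
  by have := dvdp_leq dp0 dv; rewrite leqNgt lt_size_deriv.
apply/eqP => /(congr1 (fun r : {poly F} => r`_((size p).-2))).
rewrite coef0 coef_deriv prednK; last by rewrite -subn1 subn_gt0.
move/eqP; rewrite -mulr_natr mulf_eq0 -lead_coefE lead_coef_eq0 (negPf p0) /=.
by apply/negP/natf_neq0_of_pchar0; rewrite -subn1 subn_gt0.
Qed.

(** The extra factor [p] avoids the exponent n - 1, so that n = 0 needs no separate treatment
    later. *)
Lemma mulr_deriv_exp p n : p * (p ^+ n)^`() = n%:R * p^`() * p ^+ n.
Proof.
rewrite deriv_exp; case: n => [|n]; first by rewrite !mulr0n !mul0r mulr0.
by rewrite -mulr_natl /= exprS; ring.
Qed.

Lemma coprime_poly_natr p n : (0 < n)%N -> coprimep p (n%:R).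
Proof.
move=> n0; rewrite -[n%:R]mulr1 -polyC_natr mul_polyC.
by rewrite coprimepZr ?coprimep1 // natf_neq0_of_pchar0.
Qed.

End PolynomialDivisibility.

(** * The bracket computed coefficient by coefficient in yhat *)

Section CoefficientwiseAction.
Variable F : fieldType.
Implicit Types (h pi d g c T : {poly F}) (p q w : {poly {poly F}}).

(** The coefficient of yhat^(n+l-1) in [ad_{g a_n}, c yhat^l]. *)
Definition bract h pi g n l c : {poly F} :=
  (pi * g * c^`()) *+ n - (g * hdiv h pi * c) *+ n - (delta0 h pi g * c) *+ l.

Lemma bractE h pi g n l c :
  bract h pi g n l c = n%:R * (pi * g * c^`()) - n%:R * (g * hdiv h pi * c)
    - l%:R * (delta0 h pi g * c).
Proof. by rewrite !mulr_natl. Qed.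

Lemma bract0 h pi g n l : bract h pi g n l 0 = 0.
Proof. by rewrite /bract deriv0 !mulr0 !mul0rn !subr0. Qed.

Lemma bractD h pi g n l : {morph bract h pi g n l : c c' / c + c'}.
Proof. by move=> c c'; rewrite /bract derivD !mulrDr !mulrnDl; ring. Qed.

Lemma coef_rho h pi g n p m :
  (rho h pi g n p)`_m =
    if (n <= m.+1)%N then bract h pi g n (m.+1 - n) p`_(m.+1 - n) else 0.
Proof.
have term l : ((bract h pi g n l p`_l)%:P * 'X^((n + l).-1))`_m =
    if (n + l == m.+1)%N then bract h pi g n l p`_l else 0.
  (* For n = l = 0 the exponent n + l - 1 is truncated to 0, but then the bracket itself vanishes,
     each of its terms carrying a factor n or l. *)
  rewrite coefCM coefXn; case: (posnP (n + l)) => [/eqP|nl0].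
    rewrite addn_eq0 => /andP[/eqP-> /eqP->].
    by rewrite /bract !mulr0n !subr0 mul0r.
  rewrite -(inj_eq succn_inj) prednK // eq_sym.
  by case: eqP => _; rewrite ?mulr1 ?mulr0.
rewrite /rho coef_sum.
rewrite (eq_bigr (fun l : 'I_(size p) =>
  if (n + l == m.+1)%N then bract h pi g n l p`_l else 0)); last first.
  by move=> l _; exact: term.
have [nm|nm] := leqP n m.+1; last first.
  by apply: big1 => l _; rewrite gtn_eqF // ltn_addr.
have [lp|pl] := ltnP (m.+1 - n) (size p); last first.
  rewrite (nth_default 0 pl) bract0; apply: big1 => l _.
  by case: eqP => // nl; rewrite -nl addKn leqNgt ltn_ord in pl.
rewrite (bigD1 (Ordinal lp)) //= subnKC // eqxx big1 ?addr0 // => l.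
by rewrite -val_eqE /= => ll; case: eqP => // nl; rewrite -nl addKn eqxx in ll.
Qed.

Lemma rhoD h pi g n : {morph rho h pi g n : p q / p + q}.
Proof.
move=> p q; apply/polyP => m; rewrite coefD !coef_rho coefD.
by case: ifP => _; rewrite ?bractD ?addr0.
Qed.

Lemma rho0 h pi g n : rho h pi g n 0 = 0.
Proof.
by apply/polyP => m; rewrite coef_rho !coef0 bract0; case: ifP.
Qed.

Lemma rho_sum h pi g n N (f : nat -> {poly {poly F}}) :
  rho h pi g n (\sum_(r < N) f r) = \sum_(r < N) rho h pi g n (f r).
Proof.
by apply: (big_morph (rho h pi g n)); [exact: rhoD | exact: rho0].
Qed.

Lemma rho_monomial h pi g n l c :
  rho h pi g n (c%:P * 'X^l) = (bract h pi g n l c)%:P * 'X^((n + l).-1).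
Proof.
apply/polyP => m; rewrite coef_rho !coefCM !coefXn.
case: (posnP (n + l)) => [/eqP|nl0].
  rewrite addn_eq0 => /andP[/eqP-> /eqP->]; rewrite subn0 mulr0 bract0.
  by rewrite /bract !mulr0n !subr0 mul0r.
rewrite -(inj_eq succn_inj m) prednK //; have [nm|nm] := leqP n m.+1.
  have -> : (m.+1 == n + l)%N = (m.+1 - n == l)%N.
    by rewrite -[in LHS](subnKC nm) eqn_add2l.
  by case: eqP => [->|_]; rewrite ?mulr1 // !mulr0 bract0.
by rewrite ltn_eqF ?mulr0 // ltn_addr.
Qed.

Lemma subspaceB (X : Vset F) p q : subspace X -> X p -> X q -> X (p - q).
Proof.
case=> _ [XD XZ] Xp Xq; apply: XD => //.
by rewrite -mulN1r -!polyCN; exact: XZ.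
Qed.

Lemma subspace_sum (X : Vset F) N (f : nat -> {poly {poly F}}) :
  subspace X -> (forall r, (r < N)%N -> X (f r)) -> X (\sum_(r < N) f r).
Proof.
by case=> X0 [XD _] Xf; apply: big_ind => // r _; exact: Xf.
Qed.

Lemma divall_subspace T : subspace (divall T).
Proof.
split=> [l|]; first by rewrite coef0 dvdp0.
split=> [p q dp dq l|c p dp l]; first by rewrite coefD dvdp_add.
by rewrite coefCM dvdp_mull.
Qed.

Lemma divallMC T c p : T %| c -> divall T (c%:P * p).
Proof. by move=> dv l; rewrite coefCM dvdp_mulr. Qed.

Lemma divall_factor T p : divall T p -> exists q, p = T%:P * q.
Proof.
move=> dp; exists (map_poly (fun c => c %/ T) p); apply/polyP => l.
by rewrite coefCM coef_map_id0 ?div0p // mulrC divpK.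
Qed.

(** Extensionality makes equivalent preimages equal, so that they can be rewritten inside
    [irreducible_sq] and [iso_sq]. *)
Lemma Vset_ext (X Y : Vset F) : (forall p, X p <-> Y p) -> X = Y.
Proof.
by move=> XY; apply: functional_extensionality => p;
   apply: propositional_extensionality.
Qed.

End CoefficientwiseAction.
(* mu_{ij} is weight (alpha j) i. *)
Definition weight (F : fieldType) (a b : nat) : F := (a%:R - b%:R) / a.-1%:R.

Definition upow (F : fieldType) (u : nat -> {poly F}) k (b : nat -> nat) :=
  \prod_(q < k) u q ^+ b q.

(** Encoding submodules by exponent vectors treats the P_i, the preimages of the Vbar_ij and the
    terms of the composition series uniformly. *)
Definition powdiv (F : fieldType) (u : nat -> {poly F}) k (b : nat -> nat) :
  Vset F := divall (upow u k b).

Definition incr (b : nat -> nat) (j q : nat) := (b q + (q == j))%N.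

(** * Combinatorics of raising exponents one coordinate at a time *)

Section Staircase.
Variable a : nat -> nat.
Local Notation s j := (\sum_(i < j) a i)%N.

(* Coordinate j of the exponent vector grows from 0 to a j while r runs through
   the j-th block, of length a j. *)
Definition stair (r j : nat) := minn (a j) (r - s j).

Definition in_block r j := (s j <= r < s j.+1)%N.

Lemma block_start_mono i j : (i <= j)%N -> (s i <= s j)%N.
Proof.
move=> ij; rewrite -(subnKC ij); elim: (j - i)%N => [|m IHm]; first by rewrite addn0.
by rewrite addnS big_ord_recr /=; exact: leq_trans IHm (leq_addr _ _).
Qed.

Lemma in_block_exists n r : (r < s n)%N -> exists j : 'I_n, in_block r j.
Proof.
elim: n => [|n IHn]; first by rewrite big_ord0.
have [rn _|nr rn] := ltnP r (s n).
  by have [j jr] := IHn rn; exists (widen_ord (leqnSn n) j).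
by exists ord_max; rewrite /in_block nr rn.
Qed.

Lemma in_block_inj r i j : in_block r i -> in_block r j -> i = j.
Proof.
move=> /andP[ir ri] /andP[jr rj]; case: (ltngtP i j) => // lt_ij.
  by have := block_start_mono lt_ij; lia.
by have := block_start_mono lt_ij; lia.
Qed.

Lemma in_block_stair r j : in_block r j ->
  (stair r j < a j)%N /\ r = (s j + stair r j)%N.
Proof. by rewrite /in_block /stair big_ord_recr /=; lia. Qed.

Lemma in_blockD j i : (i < a j)%N -> in_block (s j + i) j /\ stair (s j + i) j = i.
Proof. by rewrite /in_block /stair big_ord_recr /=; lia. Qed.

(** When r lies in block j, the coordinates before j are already full and those after j are still 0,
    by truncated subtraction, so only coordinate j moves. *)
Lemma stair_succ r j q : in_block r j -> stair r.+1 q = incr (stair r) j q.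
Proof.
rewrite /in_block /incr /stair => /andP[sr rs].
have [qj|jq|->] := ltngtP q j.
- by have := leq_trans (block_start_mono qj) sr; rewrite big_ord_recr /=; lia.
- by have := leq_trans rs (block_start_mono jq); move: (s q); lia.
move: rs sr; rewrite big_ord_recr /=.
by move: (s j) (a j) => x y; lia.
Qed.

Lemma stair_last n q : (q < n)%N -> stair (s n) q = a q.
Proof. by move/block_start_mono; rewrite /stair big_ord_recr /=; lia. Qed.

End Staircase.

(** * Local study of h, pi h'/h, delta_0(1) and gcd(h,h') at each u_q *)

Section FactoredPolynomial.
Variables (F : fieldType) (t k : nat) (u : nat -> {poly F}) (alpha : nat -> nat).
Hypothesis pchar0 : [pchar F] =i pred0.
Hypothesis le_kt : (k <= t)%N.
Hypothesis u_monic_irr :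
  forall i, (i < t)%N -> u i \is monic /\ irreducible_poly (u i).
Hypothesis u_inj : forall i j, (i < t)%N -> (j < t)%N -> u i = u j -> i = j.
Hypothesis alpha_ge2 : forall j, (j < k)%N -> (2 <= alpha j)%N.
Hypothesis alpha_eq1 : forall j, (k <= j < t)%N -> alpha j = 1%N.

Local Notation h := (\prod_(i < t) u i ^+ alpha i).
Local Notation pi := (\prod_(i < t) u i).
Local Notation d := (gcdp h h^`()).
Local Notation hd := (hdiv h pi).
Local Notation D0 := (delta0 h pi 1).
Local Notation bract := (bract h pi).
Local Notation rho := (rho h pi).
Local Notation cofactor q := (\prod_(i < t | i != q :> nat) u i).

Lemma ltkt j : (j < k)%N -> (j < t)%N.
Proof. by move=> jk; exact: leq_trans jk le_kt. Qed.

Lemma alpha_gt0 q : (q < t)%N -> (0 < alpha q)%N.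
Proof.
move=> qt; have [kq|/alpha_ge2/ltnW//] := leqP k q.
by rewrite alpha_eq1 ?kq.
Qed.

Lemma u_irr q : (q < t)%N -> irreducible_poly (u q).
Proof. by case/u_monic_irr. Qed.

Lemma size_u q : (q < t)%N -> (1 < size (u q))%N.
Proof. by case/u_irr. Qed.

Lemma u_neq0 q : (q < t)%N -> u q != 0.
Proof. by case/u_monic_irr => /monic_neq0. Qed.

Lemma u_coprime i j : (i < t)%N -> (j < t)%N -> i != j -> coprimep (u i) (u j).
Proof.
move=> it jt ij; have [mi ri] := u_monic_irr it; have [mj rj] := u_monic_irr jt.
by apply: monic_irreducible_coprime => //; apply: contra ij => /eqP/u_inj->.
Qed.

Lemma dvdp_u_powP n (b : nat -> nat) c : (n <= t)%N ->
  (\prod_(i < n) u i ^+ b i %| c) <-> (forall q, (q < n)%N -> u q ^+ b q %| c).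
Proof.
move=> nt; apply: (@dvdp_prodP _ n (fun i => u i ^+ b i)) => i j ik jk ij.
by apply/coprimep_expl/coprimep_expr/u_coprime => //; apply: leq_trans nt.
Qed.

Lemma h_split q : (q < t)%N ->
  h = u q ^+ alpha q * \prod_(i < t | i != q :> nat) u i ^+ alpha i.
Proof. by move=> qt; rewrite (bigD1 (Ordinal qt)). Qed.

Lemma pi_split q : (q < t)%N -> pi = u q * cofactor q.
Proof. by move=> qt; rewrite (bigD1 (Ordinal qt)). Qed.

Lemma coprime_cofactor q : (q < t)%N -> coprimep (u q) (cofactor q).
Proof.
by move=> qt; apply: coprimep_prodr => i iq; rewrite u_coprime // eq_sym.
Qed.

Lemma coprime_cofactor_pow q : (q < t)%N ->
  coprimep (u q) (\prod_(i < t | i != q :> nat) u i ^+ alpha i).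
Proof.
move=> qt; apply: coprimep_prodr => i iq; apply: coprimep_expr.
by rewrite u_coprime // eq_sym.
Qed.

(** Differentiating h lowers the power of u_q by at most one, and the factor u_q of pi restores
    it. *)
Lemma pi_deriv_h_split q : (q < t)%N ->
  let R := \prod_(i < t | i != q :> nat) u i ^+ alpha i in
  pi * h^`() = u q ^+ alpha q *
    ((alpha q)%:R * (u q)^`() * R * cofactor q + u q * cofactor q * R^`()).
Proof.
move=> qt R; rewrite (pi_split qt) (h_split qt) -/R derivM.
transitivity (cofactor q * R * (u q * (u q ^+ alpha q)^`())
  + u q * cofactor q * u q ^+ alpha q * R^`()); first by ring.
by rewrite mulr_deriv_exp; ring.
Qed.

(** The Euclidean quotient defining [hdiv] is exact: h divides pi h', as seen at each prime
    power. *)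
Lemma mulr_hdiv : pi * h^`() = hd * h.
Proof.
rewrite /hdiv divpK //; apply/dvdp_u_powP => // q qt.
by rewrite (pi_deriv_h_split qt) dvdp_mulIl.
Qed.

(** Since pi h'/h is the sum of the alpha_i u_i' pi/u_i, only the term i = q survives modulo u_q.
    The proof cancels u_q^(alpha_q) and then the remaining factor of h, coprime to u_q. *)
Lemma hdiv_mod q : (q < t)%N ->
  u q %| hd - (alpha q)%:R * (u q)^`() * cofactor q.
Proof.
move=> qt; set R := \prod_(i < t | i != q :> nat) u i ^+ alpha i.
rewrite -(@Gauss_dvdpl _ _ R) ?coprime_cofactor_pow //.
have := mulr_hdiv; rewrite (pi_deriv_h_split qt) {2}(h_split qt) -/R.
rewrite mulrCA => /(mulfI (expf_neq0 _ (u_neq0 qt))) E.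
by rewrite mulrBl -E; apply/dvdpP; exists (cofactor q * R^`()); ring.
Qed.

Lemma coprime_deriv_cofactor q n : (q < t)%N -> (0 < n)%N ->
  coprimep (u q) (n%:R * (u q)^`() * cofactor q).
Proof.
move=> qt n0; rewrite !coprimepMr coprime_cofactor // coprime_poly_natr //.
by rewrite irreducible_coprime_deriv //; exact: u_irr.
Qed.

Lemma coprime_hdiv q : (q < t)%N -> coprimep (u q) hd.
Proof.
move=> qt; apply: coprimep_congr (hdiv_mod qt) _.
by apply: coprime_deriv_cofactor; rewrite // alpha_gt0.
Qed.

Lemma delta01 : D0 = pi^`() - hd.
Proof. by rewrite /delta0 !mul1r. Qed.

Lemma delta0E g : delta0 h pi g = g^`() * pi + g * D0.
Proof. by rewrite delta01 /delta0 derivM; ring. Qed.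

(** Modulo u_q, pi' is u_q' pi/u_q and pi h'/h is alpha_q times that. The difference has the factor
    1 - alpha_q, which is nonzero for q < k; hence delta_0(1) is then a unit modulo u_q. *)
Lemma delta0_mod q : (q < t)%N ->
  u q %| D0 + (alpha q).-1%:R * (u q)^`() * cofactor q.
Proof.
move=> qt; have /dvdpP[s /eqP] := hdiv_mod qt.
rewrite subr_eq => /eqP hdE; rewrite delta01 hdE (pi_split qt) derivM.
apply/dvdpP; exists ((cofactor q)^`() - s).
by rewrite -{1}(prednK (alpha_gt0 qt)) -natr1; ring.
Qed.

Lemma coprime_delta0 q : (q < k)%N -> coprimep (u q) D0.
Proof.
move=> qk; have qt := ltkt qk; have := delta0_mod qt.
rewrite -[X in _ + X]opprK; move/coprimep_congr; apply.
rewrite -scaleN1r coprimepZr ?oppr_eq0 ?oner_eq0 //.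
apply: coprime_deriv_cofactor => //.
by rewrite -subn1 subn_gt0 alpha_ge2.
Qed.

Lemma h_factor : h = (\prod_(q < k) u q ^+ (alpha q).-1) * pi.
Proof.
have -> : \prod_(q < k) u q ^+ (alpha q).-1 = \prod_(q < t) u q ^+ (alpha q).-1.
  rewrite (big_ord_widen t (fun q => u q ^+ (alpha q).-1)) // big_mkcond /=.
  apply: eq_bigr => q _; case: ltnP => // kq.
  by rewrite alpha_eq1 // kq /=.
rewrite -big_split; apply: eq_bigr => q _.
by rewrite /= -exprSr prednK // alpha_gt0.
Qed.

(** With G the product of the u_q^(alpha_q - 1), one has h = G pi and h' = G (pi h'/h), and the two
    cofactors are coprime; so gcd(h,h') is G up to a unit. *)
Lemma dvdp_gcd_derivP c :
  (d %| c) <-> (forall q, (q < k)%N -> u q ^+ (alpha q).-1 %| c).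
Proof.
apply: iff_trans (dvdp_u_powP (fun q => (alpha q).-1) c le_kt).
set G := \prod_(q < k) _.
have pi0 : pi != 0 by apply/prodf_neq0 => q _; rewrite u_neq0.
have dE : h^`() = G * hd.
  by apply: (mulfI pi0); rewrite mulr_hdiv {2}h_factor -/G; ring.
have eqd : d %= G.
  rewrite {1}h_factor dE -/G.
  have := mulp_gcdr pi hd G; rewrite eqp_sym => /eqp_trans; apply.
  rewrite -[X in _ %= X]mulr1; apply: eqp_mull.
  rewrite gcdp_eqp1 coprimep_sym; apply: coprimep_prodr => q _.
  by rewrite coprimep_sym coprime_hdiv.
by rewrite (eqp_dvdl _ eqd).
Qed.

(** * The action on T D[yhat] and on its elementary steps *)

Local Notation mu q b := (weight F (alpha q) b).
Local Notation powdiv := (powdiv u k).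

Lemma alpha1_gt0 q : (q < k)%N -> (0 < (alpha q).-1)%N.
Proof. by move=> qk; rewrite -subn1 subn_gt0 alpha_ge2. Qed.

(* On u_q^b F[x] the operator pi * d/dx is multiplication by b u_q' pi / u_q
   modulo u_q^(b+1), while hdiv and delta_0(1) are alpha_q u_q' pi / u_q and
   (1 - alpha_q) u_q' pi / u_q modulo u_q. *)
Lemma bract_mod q g n l b c : (q < k)%N -> u q ^+ b %| c ->
  u q ^+ b.+1 %|
    bract g n l c + (l%:R - n%:R * mu q b)%:P * (g * D0 * c).
Proof.
move=> qk /dvdpP[z ->]; have qt := ltkt qk.
have /dvdpP[s1 /eqP] := hdiv_mod qt; rewrite subr_eq => /eqP hdE.
have /dvdpP[s2 /(canRL (addrK _)) D0E] := delta0_mod qt.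
have muE : (mu q b)%:P * (alpha q).-1%:R = (alpha q)%:R - b%:R.
  rewrite -!polyC_natr -polyCM -polyCB; congr _%:P.
  by rewrite /weight divfK // natf_neq0_of_pchar0 ?alpha1_gt0.
rewrite polyCB polyCM !polyC_natr bractE delta0E derivM.
have := pi_split qt; move: hdE D0E muE (mulr_deriv_exp (u q) b).
move: (pi) (hd) (D0) ((mu q b)%:P) => p H D M.
rewrite exprSr; move: (_ ^+ b)^`() (u q)^`() => U' u'.
move: (u q ^+ b) (\prod_(i < t | _) _) => U S hdE D0E muE dU ->.
apply/dvdpP.
(* The quotient collects the terms with a visible factor u_q: those in z' and g', and the errors
   [s1], [s2] of the two local congruences. The rest is a combination of the relations [muE] and
   [dU]. *)
exists (n%:R * g * S * z^`() - n%:R * g * s1 * z - l%:R * g^`() * S * z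
        - n%:R * g * M * s2 * z).
rewrite hdE D0E.
transitivity (n%:R * g * S * z * u' * U *
   (M * (alpha q).-1%:R - ((alpha q)%:R - b%:R)) +
   (n%:R * g * S * z^`() - n%:R * g * s1 * z - l%:R * g^`() * S * z
        - n%:R * g * M * s2 * z) * (U * u q) +
   n%:R * g * S * z * (u q * U' - b%:R * u' * U)); first by ring.
by rewrite muE dU !subrr !mulr0 add0r addr0.
Qed.

Local Notation Tb := (upow u k).

Lemma bract_dvd q g n l b c :
  (q < k)%N -> u q ^+ b %| c -> u q ^+ b %| bract g n l c.
Proof.
move=> qk dv; have := bract_mod g n l qk dv.
move/(dvdp_trans (dvdp_exp2l (u q) (leqnSn b))).
by rewrite dvdp_addl // dvdp_mull // dvdp_mull.
Qed.

Lemma upowP b c : (Tb b %| c) <-> (forall q, (q < k)%N -> u q ^+ b q %| c).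
Proof. exact: dvdp_u_powP. Qed.

Lemma upow_neq0 b : Tb b != 0.
Proof.
by apply/prodf_neq0 => q _; rewrite expf_neq0 // u_neq0 // ltkt.
Qed.

Lemma upow_incr b j : (j < k)%N -> Tb (incr b j) = Tb b * u j.
Proof.
move=> jk; rewrite /upow (bigD1 (Ordinal jk)) //= [in RHS](bigD1 (Ordinal jk)) //=.
rewrite /incr eqxx addn1 exprSr -!mulrA; congr (_ * _).
rewrite [RHS]mulrC; congr (_ * _); apply: eq_bigr => q.
by rewrite -val_eqE /= => /negPf->; rewrite addn0.
Qed.

Lemma upow_incrP b j c : (j < k)%N ->
  (Tb (incr b j) %| c) <-> (Tb b %| c) /\ (u j ^+ (b j).+1 %| c).
Proof.
move=> jk; split=> [/upowP dv|[/upowP dv dvj]].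
  split; last by have := dv j jk; rewrite /incr eqxx addn1.
  by apply/upowP => q qk; apply: dvdp_trans (dv q qk); rewrite dvdp_exp2l ?leq_addr.
apply/upowP => q qk; rewrite /incr.
by case: eqP => [->|_]; rewrite ?addn1 // addn0; exact: dv.
Qed.

Lemma powdiv_incrP b j p : (j < k)%N ->
  powdiv (incr b j) p <->
  powdiv b p /\ (forall l, u j ^+ (b j).+1 %| p`_l).
Proof.
move=> jk; split=> [dv|[dv dvj] l]; last by apply/upow_incrP.
by split=> l; have /(upow_incrP _ _ jk)[] := dv l.
Qed.

Lemma powdiv_rho b g n p : powdiv b p -> powdiv b (rho g n p).
Proof.
move=> dv m; rewrite coef_rho; case: ifP => _; last exact: dvdp0.
by apply/upowP => q qk; apply: bract_dvd => //; move/upowP: (dv (m.+1 - n)%N); apply.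
Qed.

Lemma powdiv_submodule b : (forall q, (q < k)%N -> (b q <= (alpha q).-1)%N) ->
  submodule h pi d (powdiv b).
Proof.
move=> bq; split; first exact: divall_subspace.
split=> [p dp l|g n p]; last exact: powdiv_rho.
apply/upowP => q qk; have /dvdp_gcd_derivP/(_ q qk) := dp l.
by apply: dvdp_trans; rewrite dvdp_exp2l ?bq.
Qed.

Lemma powdiv_rho_nil b j g n p : (j < k)%N -> u j %| g ->
  powdiv b p -> powdiv (incr b j) (rho g n p).
Proof.
move=> jk dvg dv; apply/powdiv_incrP => //; split; first exact: powdiv_rho.
move=> m; rewrite coef_rho; case: ifP => _; last exact: dvdp0.
have /upowP/(_ j jk) dvj := dv (m.+1 - n)%N.
have := bract_mod g n (m.+1 - n) jk dvj; rewrite dvdp_addl //.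
by rewrite dvdp_mull // exprS mulrAC dvdp_mulr // dvdp_mul.
Qed.

(** In the coordinate [z], the action modulo u_j sees the vector [b] only through [b j]: the
    congruence is sharp at u_j, and plain divisibility suffices at the other primes. *)
Lemma bract_upow b j g n l z : (j < k)%N ->
  exists s, bract g n l (Tb b * z) =
    Tb b * (u j * s - (l%:R - n%:R * mu j (b j))%:P * (g * D0 * z)).
Proof.
move=> jk; set C := _%:P.
have dv : Tb b %| Tb b * z := dvdp_mulIl _ _.
have /dvdpP[s sE] : Tb (incr b j) %| bract g n l (Tb b * z)
    + C * (g * D0 * (Tb b * z)).
  apply/upow_incrP => //; split; last first.
    by apply: bract_mod => //; move/upowP: dv; apply.
  rewrite dvdp_add //; last by rewrite dvdp_mull // dvdp_mull.
  by apply/upowP => q qk; apply: bract_dvd => //; move/upowP: dv; apply.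
exists s; apply: (addIr (C * (g * D0 * (Tb b * z)))).
by rewrite sE upow_incr //; move: (D0) => D; ring.
Qed.

(** The isomorphism divides each coefficient by [Tb b] and multiplies it by [Tb b']. Division is
    exact on [powdiv b], and the Euclidean quotient extends the map linearly to all polynomials. *)
Lemma iso_sq_powdiv b j b' : (j < k)%N -> b j = b' j ->
  iso_sq h pi (powdiv b) (powdiv (incr b j)) (powdiv b') (powdiv (incr b' j)).
Proof.
move=> jk bb; pose f T T' (p : {poly {poly F}}) :=
  map_poly (fun c : {poly F} => T' * (c %/ T)) p.
have coef_f T T' p l : (f T T' p)`_l = T' * (p`_l %/ T).
  by rewrite coef_map_id0 ?div0p ?mulr0.
exists (f (Tb b) (Tb b')); split.
  by move=> p q; apply/polyP => l; rewrite !(coef_f, coefD) divpD mulrDr.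
split.
  move=> c p; apply/polyP => l; rewrite !(coef_f, coefCM) !mul_polyC divpZl.
  by rewrite scalerAr.
split; first by move=> w _ l; rewrite coef_f dvdp_mulIl.
split.
  move=> w Ww; split=> dv l; have := dv l; rewrite coef_f !upow_incr //.
    by rewrite dvdp_mul2l ?upow_neq0 // -{2}(divpK (Ww l)) [_ * Tb b]mulrC
               dvdp_mul2l ?upow_neq0.
  by rewrite -{1}(divpK (Ww l)) [_ * Tb b]mulrC !dvdp_mul2l ?upow_neq0.
split.
  move=> w' Ww'; exists (f (Tb b') (Tb b) w'); split.
    by move=> l; rewrite coef_f dvdp_mulIl.
  move=> l; rewrite coefB !coef_f mulKp ?upow_neq0 //.
  by rewrite mulrC divpK // subrr dvdp0.
move=> g n w Ww m; rewrite coefB coef_f !coef_rho.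
case: ifP => _; last by rewrite div0p mulr0 subrr dvdp0.
set l := (m.+1 - n)%N; rewrite coef_f.
have /dvdpP[z ->] := Ww l; rewrite mulpK ?upow_neq0 // [z * _]mulrC.
have [s ->] := bract_upow b g n l z jk.
have [s' ->] := bract_upow b' g n l z jk.
rewrite -bb mulKp ?upow_neq0 // -mulrBr upow_incr //.
rewrite dvdp_mul2l ?upow_neq0 // opprB addrA subrK -mulrBr.
exact: dvdp_mulIl.
Qed.

Lemma upowC_powdiv b : powdiv b (Tb b)%:P.
Proof. by move=> l; rewrite coefC; case: eqP; rewrite ?dvdp0. Qed.

Lemma upowC_notin_incr b j : (j < k)%N -> ~ powdiv (incr b j) (Tb b)%:P.
Proof.
move=> jk /(_ 0%N); rewrite coefC eqxx upow_incr // -{2}[Tb b]mulr1.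
rewrite dvdp_mul2l ?upow_neq0 // dvdp1 => /eqP su.
by have := size_u (ltkt jk); rewrite su.
Qed.

Lemma dvdp_delta0_cancel q m (C : F) g c : (q < k)%N -> C != 0 ->
  coprimep (u q) g -> u q ^+ m %| C%:P * (g * D0 * c) -> u q ^+ m %| c.
Proof.
move=> qk C0 cg; rewrite mul_polyC dvdpZr // Gauss_dvdpr //.
by rewrite coprimep_expl // coprimepMr cg coprime_delta0.
Qed.

(** * Irreducibility of the elementary steps *)

Lemma weight_neq0 j b : (j < k)%N -> (b < alpha j)%N -> mu j b != 0.
Proof.
move=> jk ba; rewrite mulf_neq0 ?invr_eq0 ?natf_neq0_of_pchar0 ?alpha1_gt0 //.
by rewrite -natrB 1?ltnW // natf_neq0_of_pchar0 // subn_gt0.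
Qed.

(* ad_{a_0} lowers the yhat-degree by one and, in characteristic 0, is injective
   modulo u_j on positive degrees; iterating it lands in degree 0. *)
Lemma submodule_degree0 b j (X : Vset F) (N : nat) x : (j < k)%N ->
    submodule h pi d X -> vsubset X (powdiv b) -> X x ->
    (forall l, (N <= l)%N -> u j ^+ (b j).+1 %| x`_l) ->
    ~ (forall l, u j ^+ (b j).+1 %| x`_l) ->
  exists y, [/\ X y, ~~ (u j ^+ (b j).+1 %| y`_0)
    & forall l, (0 < l)%N -> u j ^+ (b j).+1 %| y`_l].
Proof.
move=> jk subX XW; have [_ [_ Xrho]] := subX.
elim: N x => [|N IHN] x Xx dv ndv.
  by case: ndv => l; exact: dv.
case: (boolP (u j ^+ (b j).+1 %| x`_N)) => [dvN|ndvN].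
  apply: IHN ndv => // l; rewrite leq_eqVlt => /predU1P[<-//|]; exact: dv.
case: N => [|N] in IHN dv ndvN *; first by exists x.
have coef_low m : (rho 1 0 x)`_m = bract 1 0 m.+1 x`_m.+1 by rewrite coef_rho subn0.
apply: (IHN (rho 1 0 x)); first exact: Xrho.
  by move=> l Nl; rewrite coef_low; apply: bract_dvd => //; exact: dv.
move=> /(_ N); rewrite coef_low => dvl; case/negP: ndvN.
have dvb : u j ^+ b j %| x`_N.+1 by have /upowP := XW x Xx N.+1; apply.
have := bract_mod 1 0 N.+1 jk dvb; rewrite dvdp_addr // mul0r subr0.
apply: dvdp_delta0_cancel => //; last exact: coprimep1.
exact: natf_neq0_of_pchar0.
Qed.

Lemma powdiv_irreducible b j : (j < k)%N ->
    (forall q, (q < k)%N -> (incr b j q <= (alpha q).-1)%N) ->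
  irreducible_sq h pi d (powdiv b) (powdiv (incr b j)).
Proof.
move=> jk bj; have bjj : (b j < alpha j)%N.
  by have := bj j jk; rewrite /incr eqxx addn1 => /leq_trans; apply; exact: leq_pred.
split; first by apply: powdiv_submodule => q /bj; apply: leq_trans; exact: leq_addr.
split; first exact: powdiv_submodule.
split; first by move=> p /powdiv_incrP-/(_ jk)[].
split; first by exists (Tb b)%:P; split; [exact: upowC_powdiv|exact: upowC_notin_incr].
move=> X subX UX XW.
have [XUn|/not_all_ex_not[x nx]] := classic (vsubset X (powdiv (incr b j))).
  by left.
have [Xx nUx] := imply_to_and _ _ nx; right.
have [subsX [_ Xrho]] := subX; have [_ [XD _]] := subsX.
have [||y [Xy ny0 dvy]] := submodule_degree0 (N := size x) jk subX XW Xx.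
- by move=> l sl; rewrite nth_default ?dvdp0.
- by move=> dv; apply: nUx; apply/powdiv_incrP => //; split=> //; exact: XW.
move=> w Ww; rewrite -[w]coefK poly_def.
rewrite (eq_bigr (fun l : 'I_(size w) => (w`_l)%:P * 'X^l)); last first.
  by move=> l _; rewrite mul_polyC.
apply: (subspace_sum (f := fun l => (w`_l)%:P * 'X^l)) => // l _.
have Wy := XW y Xy.
have /dvdpP[a aE] := Ww l; have /dvdpP[c cE] := Wy 0%N.
have uT : u j ^+ b j %| Tb b by have /upowP := dvdpp (Tb b); apply.
have cop : coprimep (u j) ((l.+1%:R * mu j (b j))%:P * D0 * c).
  rewrite !coprimepMr coprime_delta0 // andbT -[_%:P]mulr1 mul_polyC.
  rewrite coprimepZr ?coprimep1 /=; last first.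
    by rewrite mulf_neq0 ?natf_neq0_of_pchar0 ?weight_neq0.
  rewrite irreducible_poly_coprime; last exact/u_irr/ltkt.
  by apply: contra ny0 => dvc; rewrite cE exprS dvdp_mul.
have [g dvg] := coprimep_solve a cop.
pose z := (w`_l)%:P * 'X^l - rho g l.+1 y.
have -> : (w`_l)%:P * 'X^l = z + rho g l.+1 y by rewrite subrK.
apply: XD; last exact: Xrho.
apply: UX; apply/powdiv_incrP => //; split.
  apply: (subspaceB (divall_subspace _)); last exact: powdiv_rho.
  by apply: divallMC; exact: Ww.
move=> m; rewrite coefB coefCM coefXn coef_rho ltnS subSS.
case: (ltngtP m l) => [ml|lm|->].
(* Below degree l nothing appears, since a_(l+1) raises degrees by l; above it only the
   positive-degree coefficients of y enter. *)
- by rewrite mulr0 subrr dvdp0.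
- rewrite mulr0 sub0r dvdpNr; apply: bract_dvd => //.
  by apply: dvy; rewrite subn_gt0.
rewrite subnn mulr1.
have dvb : u j ^+ b j %| y`_0 by have /upowP := Wy 0%N; apply.
rewrite -(dvdp_addl _ (bract_mod g l.+1 0 jk dvb)) sub0r.
rewrite cE aE.
have -> : a * Tb b - bract g l.+1 0 (c * Tb b) + (bract g l.+1 0 (c * Tb b) +
    (- (l.+1%:R * mu j (b j)))%:P * (g * D0 * (c * Tb b))) =
    - (g * ((l.+1%:R * mu j (b j))%:P * D0 * c) - a) * Tb b.
  by rewrite polyCN; move: (_%:P) (bract _ _ _ _) (D0) => C B D; ring.
by rewrite exprS dvdp_mul // dvdpNr.
Qed.

(** * Isomorphism invariants of the elementary steps *)

(* On vectors concentrated in degree 0 modulo powdiv (incr b j), ad_{nu a_1}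
   acts as the scalar weight when nu inverts delta_0(1) modulo u_j. *)
Lemma rho1_degree0 b j nu v : (j < k)%N -> u j %| nu * D0 - 1 ->
    powdiv b v -> (forall m, u j ^+ (b j).+1 %| v`_m.+1) ->
  powdiv (incr b j) (rho nu 1 v - (mu j (b j))%:P%:P * v).
Proof.
move=> jk nuD vb vpos; apply/powdiv_incrP => //; split.
  apply: (subspaceB (divall_subspace _)); first exact: powdiv_rho.
  by have [_ [_]] := divall_subspace (Tb b); apply; exact: vb.
move=> m; rewrite coefB coefCM coef_rho /= subn1 /=.
case: m => [|m]; last by rewrite dvdp_sub // ?bract_dvd // dvdp_mull.
have dvb : u j ^+ b j %| v`_0 by have /upowP := vb 0%N; apply.
rewrite -(dvdp_subr _ (bract_mod nu 1 0 jk dvb)) sub0r mul1r.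
have -> : bract nu 1 0 v`_0 + (- mu j (b j))%:P * (nu * D0 * v`_0) -
    (bract nu 1 0 v`_0 - (mu j (b j))%:P * v`_0) =
    (nu * D0 - 1) * v`_0 * (- mu j (b j))%:P.
  by rewrite polyCN; move: (_%:P) (bract _ _ _ _) (D0) => C B D; ring.
by rewrite dvdp_mulr // exprS dvdp_mul.
Qed.

Lemma weight_inj j b b' : (j < k)%N -> mu j b = mu j b' -> b = b'.
Proof.
move=> jk; move/(divIf (natf_neq0_of_pchar0 pchar0 (alpha1_gt0 jk))).
move/addrI/oppr_inj => E.
wlog: b b' E / (b <= b')%N => [WL|bb].
  by have [|/ltnW] := leqP b b'; [exact: WL|move/(WL b' b (esym E))].
apply/eqP; rewrite eqn_leq bb leqNgt -subn_gt0 /=; apply/negP.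
by move/(natf_neq0_of_pchar0 pchar0); rewrite natrB // E subrr eqxx.
Qed.

Lemma iso_sq_powdiv_inj b j b' j' : (j < k)%N -> (j' < k)%N ->
    iso_sq h pi (powdiv b) (powdiv (incr b j)) (powdiv b') (powdiv (incr b' j')) ->
  j = j' /\ b j = b' j'.
Proof.
move=> jk jk' [f [fD [fZ [fW [fU [_ frho]]]]]].
have subU' := divall_subspace (Tb (incr b' j')).
have f0 : f 0 = 0 by apply: (addrI (f 0)); rewrite -fD !addr0.
have jj : j = j'.
  apply/eqP; apply: contraT => jj'.
  have [g0 dvg] : exists g, u j %| g * u j' - 1.
    by apply: coprimep_solve; rewrite u_coprime ?ltkt.
  have cg := coprimep_congr dvg (coprimep1 _).
  (* Degree 1 is taken because a_0 kills degree 0. The polynomial g0 u_j' is 1 modulo u_j, so its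
     a_0 does not kill [w], whereas it annihilates the target. *)
  pose w := (Tb b)%:P * 'X^1 : {poly {poly F}}.
  have Ww : powdiv b w by exact: divallMC (dvdpp _).
  have : powdiv (incr b j) (rho (g0 * u j') 0 w).
    apply/fU; first exact: powdiv_rho.
    have -> : f (rho (g0 * u j') 0 w) = (f (rho (g0 * u j') 0 w)
      - rho (g0 * u j') 0 (f w)) - (- rho (g0 * u j') 0 (f w)).
      by rewrite opprK subrK.
    apply: (subspaceB subU'); first exact: frho.
    rewrite -sub0r; apply: (subspaceB subU'); first by case: subU'.
    by apply: powdiv_rho_nil => //; [exact: dvdp_mulIr | exact: fW].
  rewrite rho_monomial => /powdiv_incrP-/(_ jk)[_ /(_ 0%N)].
  rewrite coefCM coefXn mulr1 => dv.
  have uT : u j ^+ b j %| Tb b by have /upowP := dvdpp (Tb b); apply.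
  have := bract_mod (g0 * u j') 0 1 jk uT; rewrite dvdp_addr // mul0r subr0.
  move/(dvdp_delta0_cancel jk (oner_neq0 _) cg) => dvT.
  case: (@upowC_notin_incr b j jk); apply/powdiv_incrP => //.
  split=> [|l]; first exact: upowC_powdiv.
  by rewrite coefC; case: eqP => // _; exact: dvdp0.
subst j'; split=> //.
have [nu nuD] := coprimep_solve 1 (coprime_delta0 jk).
pose w := (Tb b)%:P : {poly {poly F}}; pose v := f w.
have Ww : powdiv b w by exact: upowC_powdiv.
have Wv : powdiv b' v by exact: fW.
(* The generator [w] is killed by ad_{a_0}, hence so is its image [v] in the quotient, which is
   therefore concentrated in degree 0. *)
have vpos m : u j ^+ (b' j).+1 %| v`_m.+1.
  have r0 : rho 1 0 w = 0.
    by apply/polyP => l; rewrite coef_rho subn0 /w coefC coef0 bract0.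
  have := frho 1 0%N w Ww; rewrite r0 f0 sub0r => /powdiv_incrP-/(_ jk)[_ /(_ m)].
  rewrite coefN dvdpNr coef_rho subn0 => dvl.
  have dvb : u j ^+ b' j %| v`_m.+1 by have /upowP := Wv m.+1; apply.
  have := bract_mod 1 0 m.+1 jk dvb; rewrite dvdp_addr // mul0r subr0.
  apply: dvdp_delta0_cancel => //; last exact: coprimep1.
  exact: natf_neq0_of_pchar0.
have Rw : powdiv (incr b j) (rho nu 1 w - (mu j (b j))%:P%:P * w).
  by apply: rho1_degree0 => // m; rewrite coefC dvdp0.
have Rv : powdiv (incr b' j) (rho nu 1 v - (mu j (b' j))%:P%:P * v).
  exact: rho1_degree0.
have fB x y : f (x - y) = f x - f y.
  have -> : x - y = x + (-1)%:P%:P * y by rewrite !polyCN mulN1r.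
  by rewrite fD fZ !polyCN mulN1r.
have WRw : powdiv b (rho nu 1 w - (mu j (b j))%:P%:P * w).
  by case/powdiv_incrP: Rw.
move/(fU _ WRw): Rw; rewrite fB fZ -/v => fRw.
have := subspaceB subU' (subspaceB subU' fRw Rv) (frho nu 1%N w Ww).
rewrite -/v.
have -> : f (rho nu 1 w) - (mu j (b j))%:P%:P * v -
    (rho nu 1 v - (mu j (b' j))%:P%:P * v) - (f (rho nu 1 w) - rho nu 1 v)
    = (mu j (b' j) - mu j (b j))%:P%:P * v by rewrite !polyCB; ring.
(* If the two eigenvalues differed, their nonzero difference could be cancelled and [v] would vanish
   in the quotient, against the injectivity of f. *)
move=> scal; apply: (weight_inj jk); apply/eqP; apply: contraT => mumu.
case: (@upowC_notin_incr b j jk); apply/(fU _ Ww) => l.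
by have := scal l; rewrite coefCM mul_polyC dvdpZr // subr_eq0 eq_sym.
Qed.

(** * The filtration P_i and the nilpotent ideal *)

Local Notation theta i := (fun q => minn (alpha q).-1 i).
Local Notation mh := (\max_(j < k) (alpha j).-1)%N.
Local Notation P i := (powdiv (theta i)).

Lemma powdiv_ext b b' : (forall q, (q < k)%N -> b q = b' q) -> powdiv b = powdiv b'.
Proof.
move=> bb; congr (divall _); rewrite /upow; apply: eq_bigr => q _.
by rewrite bb.
Qed.

Lemma inK_powdiv : inK d = powdiv (fun q => (alpha q).-1).
Proof.
apply: Vset_ext => p; split=> dv l; first by apply/upowP/dvdp_gcd_derivP.
by apply/dvdp_gcd_derivP/upowP.
Qed.

Lemma theta_submodule i : submodule h pi d (P i).
Proof. by apply: powdiv_submodule => q _; exact: geq_minl. Qed.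

Lemma theta0 p : P 0 p.
Proof. by move=> l; apply/upowP => q _; rewrite minn0 dvd1p. Qed.

Lemma theta_max : P mh = inK d.
Proof.
rewrite inK_powdiv; apply: powdiv_ext => q qk; apply/minn_idPl.
exact: (leq_bigmax (Ordinal qk)).
Qed.

(** Where alpha_q - 1 <= i, the exponent of u_q no longer grows from P_i to P_{i+1}; elsewhere u_q
    divides g and the action gains one power. *)
Lemma rho_theta_nil i g n p :
  \prod_(j < k) u j %| g -> P i p -> P i.+1 (rho g n p).
Proof.
move=> dvg Pp l; apply/upowP => q qk; have Pr := @powdiv_rho _ g n _ Pp.
have [qi|iq] := leqP (alpha q).-1 i.
  rewrite (minn_idPl _) ?leqW //; have /upowP/(_ q qk) := Pr l.
  by rewrite (minn_idPl _).
have uqg : u q %| g.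
  by apply: dvdp_trans dvg; rewrite (bigD1 (Ordinal qk)) //= dvdp_mulIl.
have /powdiv_incrP-/(_ qk)[_ /(_ l)] := powdiv_rho_nil n qk uqg Pp.
by rewrite (minn_idPr iq) (minn_idPr (ltnW iq)).
Qed.

(* A simple submodule lies in P_i or meets it in 0, and the ideal N maps P_i into
   P_{i+1}; hence N kills every simple submodule. *)
Lemma simple_rho_nil (X : Vset F) : irreducible_sq h pi d X (inK d) ->
  forall g n p, \prod_(j < k) u j %| g -> X p -> inK d (rho g n p).
Proof.
move=> [[subX [XK Xrho]] [_ [KX [_ Xirr]]]].
have subK : submodule h pi d (inK d) by rewrite -theta_max; exact: theta_submodule.
suff claim i : (i <= mh)%N -> vsubset X (P i) \/
    (forall g n p, \prod_(j < k) u j %| g -> X p -> inK d (rho g n p)).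
  have [|XP g n p _ Xp|//] := claim mh; first exact: leqnn.
  by have [_ [_]] := subK; apply; move: (XP p Xp); rewrite theta_max.
elim: i => [_|i IHi im]; first by left=> p _; exact: theta0.
have [XP|] := IHi (ltnW im); last by right.
have [[PP0 [PPD PPZ]] [PK Prho]] := theta_submodule i.+1.
have [X0 [XD XZ]] := subX.
(* Simplicity is applied to the intersection of X with P_{i+1}. *)
have [|||XiK|XXi] := Xirr (fun p => X p /\ P i.+1 p).
- split; first (split; first by split).
    split=> [p q [Xp Pp] [Xq Pq]|c p [Xp Pp]].
      by split; [exact: XD | exact: PPD].
    by split; [exact: XZ | exact: PPZ].
  split=> [p Kp|g n p [Xp Pp]].
    by split; [exact: XK | exact: PK].
  by split; [exact: Xrho | exact: Prho].
- by move=> p Kp; split; [exact: XK | exact: PK].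
- by move=> p [].
- right=> g n p mg Xp; apply: XiK; split; first exact: Xrho.
  by apply: rho_theta_nil => //; exact: XP.
- by left=> p /XXi[].
Qed.

Lemma semisimple_rho_nil : semisimple h pi d ->
  forall g n p, \prod_(j < k) u j %| g -> inK d (rho g n p).
Proof.
move=> ss g n p mg; have [N [Xs [xs [Xirr Kp]]]] := ss p.
have [subK [_ Krho]] : submodule h pi d (inK d).
  by rewrite -theta_max; exact: theta_submodule.
have -> : rho g n p = rho g n (p - \sum_(r < N) xs r)
    + \sum_(r < N) rho g n (xs r).
  by rewrite -rho_sum -rhoD subrK.
have [_ [KD _]] := subK; apply: KD; first exact: Krho.
apply: (subspace_sum (f := fun r => rho g n (xs r))) => // r rN.
by have [Xr Xsr] := Xirr r rN; exact: simple_rho_nil Xr _ _ _ _ _.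
Qed.

Lemma semisimple_max_le1 : semisimple h pi d -> (mh <= 1)%N.
Proof.
move=> ss; apply/bigmax_leqP => -[j jk] _ /=; rewrite leqNgt; apply/negP => aj.
have jt := ltkt jk.
(* Take g = u_1...u_k, n = 1 and the vector 1. The result -g pi h'/h would be divisible by u_j^2 if
   alpha_j >= 3, but u_j divides g only once and is coprime to pi h'/h. *)
have := semisimple_rho_nil ss 1 1 (dvdpp _) => /(_ 0%N).
rewrite coef_rho /= coef1 /= bractE derivC !mulr0 mul0r subr0 sub0r mul1r mulr1.
rewrite dvdpNr => /dvdp_gcd_derivP/(_ j jk).
rewrite Gauss_dvdpl ?coprimep_expl ?coprime_hdiv //.
move/(dvdp_trans (dvdp_exp2l (u j) aj)); rewrite (bigD1 (Ordinal jk)) //=.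
rewrite expr2 dvdp_mul2l ?u_neq0 //; apply/negP.
rewrite -irreducible_poly_coprime; last exact: u_irr.
by apply: coprimep_prodr => i ij; rewrite u_coprime ?ltkt // eq_sym.
Qed.

Lemma max_le1P : (mh <= 1)%N <-> ~ exists q : {poly F}, (1 < size q)%N /\ q ^+ 3 %| h.
Proof.
split=> [m1 [q [sq dvq]]|ncube].
  have qh : q %| h by apply: dvdp_trans dvq; rewrite dvdp_exp.
  (* Otherwise q would be coprime to h while dividing it, hence constant. *)
  have [i dvi] : exists i : 'I_t, u i %| q.
    apply/existsP; apply: contraT; rewrite negb_exists => /forallP nd.
    have : coprimep q h.
      apply: coprimep_prodr => i _; apply: coprimep_expr; rewrite coprimep_sym.
      by rewrite irreducible_poly_coprime ?nd //; exact: u_irr.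
    by move/(coprimep_dvdl qh); rewrite coprimepp => /eqP sq1; rewrite sq1 in sq.
  have : u i ^+ 3 %| h by apply: dvdp_trans dvq; exact: dvdp_exp2r.
  rewrite (h_split (ltn_ord i)) Gauss_dvdpl; last first.
    by apply: coprimep_expl; exact: coprime_cofactor_pow.
  rewrite dvdp_Pexp2l ?size_u // => a3.
  have [ki|ik] := leqP k i; first by rewrite alpha_eq1 ?ki ?ltn_ord in a3.
  have := leq_trans (leq_bigmax (Ordinal ik)) m1 => /=.
  by rewrite leqNgt -subn1 ltn_subRL a3.
apply/bigmax_leqP => -[j jk] _ /=; rewrite leqNgt; apply/negP => aj.
case: ncube; exists (u j); split; first by rewrite size_u ?ltkt.
rewrite (h_split (ltkt jk)) dvdp_mulr // dvdp_exp2l //.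
by move: aj; rewrite -subn1 ltn_subRL.
Qed.


(** * Decomposition of the layers S_i by the idempotents e_j *)

Section Idempotents.
Variable e : nat -> {poly F}.
Hypothesis e_idem : forall j q, (j < k)%N -> (q < k)%N ->
  u q ^+ (alpha q).-1 %| e j - (q == j)%:R.

Local Notation Th i := (Theta u alpha k i).
Local Notation W i j := (Wsq (Th i) (Th i.+1) (e j)).
(** Exponents of the preimage of Vbar_ij: i at u_j and i + 1 elsewhere, capped by alpha_q - 1.
    Raising the exponent at j gives P_{i+1}. *)
Local Notation omega i j := (fun q => minn (alpha q).-1 (i + (q != j))).

Lemma dvdp_idem_other j q m : (j < k)%N -> (q < k)%N -> q != j ->
  (m <= (alpha q).-1)%N -> u q ^+ m %| e j.
Proof.
move=> jk qk qj mq; have := e_idem jk qk; rewrite (negPf qj) subr0.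
by apply: dvdp_trans; exact: dvdp_exp2l.
Qed.

Lemma dvdp_idem_self j m : (j < k)%N -> (m <= (alpha j).-1)%N -> u j ^+ m %| e j - 1.
Proof.
move=> jk mj; have := e_idem jk jk; rewrite eqxx.
by apply: dvdp_trans; exact: dvdp_exp2l.
Qed.

Lemma coprime_idem j : (j < k)%N -> coprimep (u j) (e j).
Proof.
move=> jk; apply: (@coprimep_congr _ _ _ 1); last exact: coprimep1.
by have := @dvdp_idem_self j 1 jk; rewrite expr1; apply; exact: alpha1_gt0.
Qed.

Lemma dvdp_Theta i q m : (q < k)%N -> (m <= minn (alpha q).-1 i)%N -> u q ^+ m %| Th i.
Proof.
move=> qk mi; have /(upowP (theta i))/(_ q qk) := dvdpp (Th i).
by apply: dvdp_trans; exact: dvdp_exp2l.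
Qed.

Lemma incr_omega i j : (j < k)%N -> (i.+2 <= alpha j)%N ->
  powdiv (incr (omega i j) j) = P i.+1.
Proof.
move=> jk ij; apply: powdiv_ext => q qk; rewrite /incr.
by case: eqP => [->|_] /=; lia.
Qed.

Lemma omega_self i j : (i.+2 <= alpha j)%N -> minn (alpha j).-1 (i + (j != j)) = i.
Proof. by rewrite eqxx; lia. Qed.

(* As e_j is 1 modulo u_j and 0 modulo the other u_q, adding Theta_{i+1} turns
   the ideal of Theta_i e_j into the one of Theta_{i+1} / u_j. *)
Lemma Wsq_powdiv i j : (j < k)%N -> (i.+2 <= alpha j)%N -> W i j = powdiv (omega i j).
Proof.
move=> jk ij; apply: Vset_ext => p; split.
  move=> [q [r [dvr ->]]] l; apply/upowP => s sk; rewrite coefD coefCM.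
  have /(upowP (theta i.+1))/(_ s sk) dvrs := dvr l.
  rewrite dvdp_add //; last by apply: dvdp_trans dvrs; apply: dvdp_exp2l; case: eqP; lia.
  rewrite dvdp_mulr //; case: (eqVneq s j) => [->|sj].
    by rewrite dvdp_mulr // dvdp_Theta //; lia.
  by rewrite dvdp_mull // dvdp_idem_other //; lia.
move=> dvp; have [z pE] : exists z, p = (Th i)%:P * z.
  apply: divall_factor => l; apply/(upowP (theta i)) => q qk; have /upowP/(_ q qk) := dvp l.
  by apply: dvdp_trans; apply: dvdp_exp2l; case: eqP; lia.
exists z, (p - (Th i * e j)%:P * z); split; last by rewrite addrC subrK.
move=> l; apply/(upowP (theta i.+1)) => q qk; rewrite coefB coefCM.
case: (eqVneq q j) => [->|qj].
  rewrite pE coefCM mulrAC [X in _ - X]mulrC; apply: dvdp_mul_sub1.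
  by apply: dvdp_idem_self => //; lia.
rewrite dvdp_sub //; last by rewrite dvdp_mulr // dvdp_mull // dvdp_idem_other //; lia.
by have /upowP/(_ q qk) := dvp l; rewrite qj addn1.
Qed.

(** One quotient z = p / Theta_i serves all j: modulo the primes with alpha_q >= i + 2 the chosen
    e_j sum to 1, and at the others Theta_i already has the full exponent. *)
Lemma layer_sum i p : P i p -> exists qs : nat -> {poly {poly F}},
  P i.+1 (p - \sum_(j < k | (i.+2 <= alpha j)%N) (Th i * e j)%:P * qs j).
Proof.
move/divall_factor => [z ->]; exists (fun=> z) => l; apply/upowP => q qk.
rewrite coefB coefCM coef_sum.
rewrite (eq_bigr (fun j : 'I_k => e j * (Th i * z`_l))); last first.
  by move=> j _; rewrite coefCM mulrCA mulrA.
have [iq|qi] := leqP i.+2 (alpha q); last first.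
  have dv c : u q ^+ minn (alpha q).-1 i.+1 %| Th i * c.
    by rewrite dvdp_mulr // dvdp_Theta //; lia.
  by apply: dvdp_sub; [exact: dv | apply: dvdp_sum => j _; exact/dvdp_mull/dv].
rewrite (bigD1 (Ordinal qk)) //= opprD addrA dvdp_sub //.
  by apply: dvdp_mul_sub1; apply: dvdp_idem_self => //; lia.
apply: dvdp_sum => j /andP[_ jq].
rewrite dvdp_mulr // dvdp_idem_other //; last by lia.
by rewrite eq_sym.
Qed.

(** At u_j every summand other than [ws j] already has the exponent required by P_{i+1}, so the sum
    forces it on [ws j] as well. *)
Lemma layer_direct i (ws : nat -> {poly {poly F}}) :
    (forall j, (j < k)%N -> (i.+2 <= alpha j)%N -> W i j (ws j)) ->
    P i.+1 (\sum_(j < k | (i.+2 <= alpha j)%N) ws j) ->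
  forall j, (j < k)%N -> (i.+2 <= alpha j)%N -> P i.+1 (ws j).
Proof.
move=> Wws Psum j jk ij l; apply/upowP => q qk.
have dvw r : (r < k)%N -> (i.+2 <= alpha r)%N -> q != r ->
    u q ^+ minn (alpha q).-1 i.+1 %| (ws r)`_l.
  move=> rk ir qr; have := Wws r rk ir; rewrite Wsq_powdiv // => /(_ l)/upowP/(_ q qk).
  by rewrite qr addn1.
case: (eqVneq q j) => [qj|]; last exact: dvw.
have := Psum l; rewrite (bigD1 (Ordinal jk)) //= coefD => /upowP/(_ q qk).
rewrite dvdp_addl // coef_sum; apply: dvdp_sum => r /andP[ir rj].
by apply: dvw => //; rewrite qj eq_sym.
Qed.

Lemma layer_coords i j q : (j < k)%N -> (i.+2 <= alpha j)%N ->
  P i.+1 ((Th i * e j)%:P * q) <-> (forall l, u j %| q`_l).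
Proof.
move=> jk ij; split=> [Pq l|dvq l].
  have : upow u k (incr (theta i) j) %| Th i * (e j * q`_l).
    apply/upowP => s sk; have := Pq l; rewrite coefCM mulrA => /upowP/(_ s sk).
    by apply: dvdp_trans; apply: dvdp_exp2l; rewrite /incr; case: eqP => [->|_]; lia.
  rewrite upow_incr // dvdp_mul2l ?upow_neq0 // Gauss_dvdpr //.
  exact: coprime_idem.
rewrite coefCM; apply/upowP => s sk; case: (eqVneq s j) => [->|sj].
  have -> : minn (alpha j).-1 i.+1 = i.+1 by lia.
  by rewrite exprSr dvdp_mul // dvdp_mulr // dvdp_Theta //; lia.
by rewrite dvdp_mulr // dvdp_mull // dvdp_idem_other //; lia.
Qed.

(** Modulo u_j, nu delta_0(1) is 1 and e_q is 1 or 0 according to whether q = j, so the general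
    congruence becomes the Witt formula. The leading sign is that of the isomorphism with the Witt
    algebras. *)
Lemma layer_action nu i j q g f n l : (j < k)%N -> (i.+2 <= alpha j)%N -> (q < k)%N ->
    \prod_(j < k) u j %| nu * D0 - 1 ->
  P i.+1 (- rho (g * e q * nu) n ((Th i * e j * f)%:P * 'X^l)
    - (if q == j then
         (Th i * e j * (f * g) * (l%:R - n%:R * mu j i)%:P)%:P * 'X^((n + l).-1)
       else 0)).
Proof.
move=> jk ij qk nuD; set C := (_ - _)%:P.
have uD s : (s < k)%N -> u s %| nu * D0 - 1.
  move=> sk; apply: dvdp_trans nuD; rewrite (bigD1 (Ordinal sk)) //=.
  exact: dvdp_mulIl.
set c := Th i * e j * f.
have -> : (if q == j then (Th i * e j * (f * g) * C)%:P * 'X^((n + l).-1) else 0)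
    = ((q == j)%:R * (C * g * c))%:P * 'X^((n + l).-1).
  case: eqP => _; rewrite ?mul0r ?mul1r //; congr (_%:P * _); rewrite /c; ring.
rewrite rho_monomial -mulNr -mulrBl -polyCN -polyCB.
apply: divallMC; apply/upowP => s sk.
case: (eqVneq s j) => [->|sj]; last first.
  have dvc : u s ^+ minn (alpha s).-1 i.+1 %| c.
    by rewrite dvdp_mulr // dvdp_mull // dvdp_idem_other //; lia.
  by apply: dvdp_sub; [rewrite dvdpNr bract_dvd | rewrite dvdp_mull // dvdp_mull].
have -> : minn (alpha j).-1 i.+1 = i.+1 by lia.
have dvc : u j ^+ i %| c by rewrite /c -mulrA dvdp_mulr // dvdp_Theta //; lia.
rewrite -(dvdp_addr _ (bract_mod (g * e q * nu) n l jk dvc)) -/C.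
have -> : bract (g * e q * nu) n l c + C * (g * e q * nu * D0 * c) +
   (- bract (g * e q * nu) n l c - (q == j)%:R * (C * g * c)) =
   (e q * (nu * D0 - 1) + (e q - (q == j)%:R)) * c * (C * g).
  by move: (bract _ _ _ _) (D0) => B D; ring.
rewrite dvdp_mulr // exprS dvdp_mul // dvdp_add ?dvdp_mull ?uD //.
rewrite eq_sym; have := e_idem qk jk; apply: dvdp_trans.
by rewrite -{1}[u j]expr1 dvdp_exp2l // alpha1_gt0.
Qed.

(** All alpha_j with j < k equal 2, so P_1 = 0 and the decomposition of the single layer S_0 is one
    of the whole module. *)
Lemma semisimple_of_max_le1 : (mh <= 1)%N -> semisimple h pi d.
Proof.
move=> m1 p.
have a2 j : (j < k)%N -> alpha j = 2.
  move=> jk; have := leq_trans (leq_bigmax (Ordinal jk)) m1 => /=.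
  by have := alpha_ge2 jk; lia.
have KE : inK d = P 1.
  by rewrite inK_powdiv; apply: powdiv_ext => q qk; rewrite a2.
have [qs Pqs] := layer_sum (theta0 p).
exists k, (fun r => W 0 r), (fun r => (Th 0 * e r)%:P * qs r); split; last first.
  rewrite KE; rewrite (eq_bigl (fun=> true)) in Pqs => // j.
  by rewrite a2.
move=> r rk; have ar : (2 <= alpha r)%N by rewrite a2.
split; last first.
  exists (qs r), 0; split; last by rewrite addr0.
  by case: (divall_subspace (Th 1)).
rewrite KE -(incr_omega rk ar) Wsq_powdiv //; apply: powdiv_irreducible => // q qk.
by rewrite /incr a2 //; case: eqP; lia.
Qed.

(** * The composition series and the labelling of its factors *)

Lemma composition_chain :
  let L := (\sum_(j < k) (alpha j).-1)%N in
  let valid := fun i j => [&& (i < mh)%N, (j < k)%N & (i.+2 <= alpha j)%N] in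
  exists X : nat -> Vset F, composition_series h pi d X L /\
  exists phi : nat -> nat * nat,
    (forall r, (r < L)%N -> valid (phi r).1 (phi r).2 /\
       iso_sq h pi (X r) (X r.+1) (W (phi r).1 (phi r).2) (P (phi r).1.+1)) /\
    (forall r s, (r < L)%N -> (s < L)%N -> phi r = phi s -> r = s) /\
    (forall i j, valid i j -> exists r, (r < L)%N /\ phi r = (i, j)).
Proof.
move=> L valid; pose a q := (alpha q).-1.
have XS r j : in_block a r j -> powdiv (stair a r.+1) = powdiv (incr (stair a r) j).
  by move=> rj; apply: powdiv_ext => q _; exact: stair_succ.
exists (fun r => powdiv (stair a r)); split.
  split; first by move=> p l; apply/upowP => q _; rewrite /stair minn0 dvd1p.
  split.
    move=> p; rewrite inK_powdiv; have -> // : powdiv (stair a L) = powdiv a.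
    by apply: powdiv_ext => q qk; exact: (@stair_last a).
  move=> r rL; have [j rj] := @in_block_exists a _ _ rL.
  rewrite (XS _ _ rj); apply: powdiv_irreducible => // q qk.
  by rewrite -stair_succ // geq_minl.
(* The label of r is (height reached in its block, block index); the default pair occurs only for r
   >= L. *)
pose phi r := if [pick j : 'I_k | in_block a r j] is Some j
  then (stair a r j, nat_of_ord j) else (0%N, 0%N).
have phiE r (j : 'I_k) : in_block a r j -> phi r = (stair a r j, nat_of_ord j).
  move=> rj; rewrite /phi; case: pickP => [j' rj'|/(_ j)]; last by rewrite rj.
  by rewrite (in_block_inj rj rj').
have aj j : (j < k)%N -> (a j <= mh)%N.
  by move=> jk; exact: (leq_bigmax (Ordinal jk)).
exists phi; split.
  move=> r rL; have [j rj] := @in_block_exists a _ _ rL; rewrite (phiE _ _ rj) /=.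
  have [lt_a _] := in_block_stair rj; have al : ((stair a r j).+2 <= alpha j)%N.
    by move: lt_a; rewrite /a; lia.
  split; first by rewrite /valid al ltn_ord (leq_trans lt_a) // aj.
  (* The staircase and [omega] may differ away from j, but they agree at j, which determines the
     factor. *)
  rewrite (XS _ _ rj) Wsq_powdiv // -(incr_omega (ltn_ord j) al).
  by apply: iso_sq_powdiv => //; rewrite omega_self.
split.
  move=> r s rL sL; have [j rj] := @in_block_exists a _ _ rL.
  have [j' sj] := @in_block_exists a _ _ sL; rewrite (phiE _ _ rj) (phiE _ _ sj) => -[ee jj].
  have [_ ->] := in_block_stair rj; have [_ ->] := in_block_stair sj.
  by rewrite ee jj.
move=> i j /and3P[_ jk ij]; have ia : (i < a j)%N by rewrite /a; lia.
have [bl st] := @in_blockD a _ _ ia.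
exists (\sum_(q < j) a q + i)%N; split; last by rewrite (phiE _ (Ordinal jk)) //= st.
have /andP[_ /leq_trans] := bl; apply; exact: (@block_start_mono a).
Qed.

Lemma iso_sq_layer i j i' j' : (j < k)%N -> (i.+2 <= alpha j)%N ->
    (j' < k)%N -> (i'.+2 <= alpha j')%N ->
  iso_sq h pi (W i j) (P i.+1) (W i' j') (P i'.+1) <-> (i = i' /\ j = j').
Proof.
move=> jk ij jk' ij'; split=> [|[<- <-]].
  rewrite !Wsq_powdiv // -(incr_omega jk ij) -(incr_omega jk' ij').
  move/(iso_sq_powdiv_inj jk jk') => [jj]; rewrite !omega_self //.
by rewrite Wsq_powdiv // -(incr_omega jk ij); exact: iso_sq_powdiv.
Qed.

Lemma layer_irreducible i j : (j < k)%N -> (i.+2 <= alpha j)%N ->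
  irreducible_sq h pi d (W i j) (P i.+1).
Proof.
move=> jk ij; rewrite Wsq_powdiv // -(incr_omega jk ij).
apply: powdiv_irreducible => // q qk; rewrite /incr.
by case: eqP => [->|_]; lia.
Qed.

Lemma theta_strict i : (i < mh)%N ->
  vsubset (P i.+1) (P i) /\ exists p, P i p /\ ~ P i.+1 p.
Proof.
move=> im; split.
  move=> p Pp l; apply/upowP => q qk; have /upowP/(_ q qk) := Pp l.
  by apply: dvdp_trans; apply: dvdp_exp2l; lia.
(* For i < m_h some Vbar_ij occurs in S_i, and a nonzero vector of it separates P_i from P_{i+1}. *)
have [j jk ij] : exists2 j, (j < k)%N & (i.+2 <= alpha j)%N.
  case: (boolP [exists j : 'I_k, (i.+2 <= alpha j)%N]) => [/existsP[j ij]|].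
    by exists j.
  rewrite negb_exists => /forallP nij; move: im; rewrite ltnNge => /negP[].
  by apply/bigmax_leqP => j _; have := nij j; lia.
have [_ [_ [_ [[w [Ww nUw]] _]]]] := layer_irreducible jk ij.
exists w; split=> // l; apply/upowP => q qk; move: Ww.
rewrite Wsq_powdiv // => /(_ l)/upowP/(_ q qk).
by apply: dvdp_trans; apply: dvdp_exp2l; case: eqP; lia.
Qed.

End Idempotents.
End FactoredPolynomial.

(** * Structure of HH^2(A) as a Lie module, assembled from the preceding results *)

Theorem theorem6p7 (F : fieldType) (t k : nat) (u : nat -> {poly F})
    (alpha : nat -> nat) (e : nat -> {poly F}) (nu : {poly F}) :
  [pchar F] =i pred0 ->
  (0 < k)%N -> (k <= t)%N ->
  (forall i, (i < t)%N -> u i \is monic /\ irreducible_poly (u i)) ->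
  (forall i j, (i < t)%N -> (j < t)%N -> u i = u j -> i = j) ->
  (forall j, (j < k)%N -> (2 <= alpha j)%N) ->
  (forall j, (k <= j < t)%N -> alpha j = 1%N) ->
  let h := \prod_(i < t) u i ^+ alpha i in
  let pi := \prod_(i < t) u i in
  let d := gcdp h h^`() in
  let pik := \prod_(j < k) u j in
  let mh := (\max_(j < k) (alpha j).-1)%N in
  let P := fun i => divall (Theta u alpha k i) in
  let W := fun i j => Wsq (Theta u alpha k i) (Theta u alpha k i.+1) (e j) in
  let valid := fun i j => [&& (i < mh)%N, (j < k)%N & (i.+2 <= alpha j)%N] in
  (* e_0,...,e_{k-1}: the orthogonal idempotents of D with D e_j = F[x]/u_j^(alpha_j-1) *)
  (forall j q, (j < k)%N -> (q < k)%N -> u q ^+ (alpha q).-1 %| e j - (q == j)%:R) ->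
  (* nu delta_0(1) = 1 mod u_1...u_k *)
  pik %| nu * delta0 h pi 1 - 1 ->
  (* (a) *)
  ((forall p, P 0%N p) /\ (forall p, P mh p <-> inK d p) /\
   (forall i, (i <= mh)%N -> submodule h pi d (P i)) /\
   (forall i, (i < mh)%N -> vsubset (P i.+1) (P i) /\ exists p, P i p /\ ~ P i.+1 p)) /\
  (* (b) *)
  (forall i, (i < mh)%N ->
     (* (i): Z(HH^1) + N acts trivially on S_i *)
     (forall g n p, pik %| g -> P i p -> P i.+1 (rho h pi g n p)) /\
     (* S_i = (+)_{alpha_j >= i+2} Vbar_ij *)
     (forall j, valid i j -> submodule h pi d (W i j) /\ vsubset (W i j) (P i)) /\
     (forall p, P i p -> exists qs : nat -> {poly {poly F}},
        P i.+1 (p - \sum_(j < k | (i.+2 <= alpha j)%N) (Theta u alpha k i * e j)%:P * qs j)) /\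
     (forall ws : nat -> {poly {poly F}},
        (forall j, valid i j -> W i j (ws j)) ->
        P i.+1 (\sum_(j < k | (i.+2 <= alpha j)%N) ws j) ->
        forall j, valid i j -> P i.+1 (ws j)) /\
     (forall j, valid i j ->
        let mu := (alpha j - i)%:R / (alpha j).-1%:R : F in
        (* (ii) irreducible *)
        irreducible_sq h pi d (W i j) (P i.+1) /\
        (* (ii) the map Dbar_j[yhat] -> Vbar_ij, f yhat^l |-> Theta_i e_j f yhat^l
           is well defined and injective (surjective by definition of W) *)
        (forall q, P i.+1 ((Theta u alpha k i * e j)%:P * q) <-> forall l, u j %| q`_l) /\
        (* (iii) action of g ebar_q (x) w_m  (= - ad_{g e_q nu a_{m+1}}, n = m+1) *)
        (forall (q : nat) (g f : {poly F}) (n l : nat), (q < k)%N ->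
           P i.+1 (- rho h pi (g * e q * nu) n ((Theta u alpha k i * e j * f)%:P * 'X^l)
                   - (if q == j then
                        (Theta u alpha k i * e j * (f * g) * (l%:R - n%:R * mu)%:P)%:P
                          * 'X^((n + l).-1)
                      else 0))))) /\
  (* (b)(iv) *)
  (forall i j i' j', valid i j -> valid i' j' ->
     (iso_sq h pi (W i j) (P i.+1) (W i' j') (P i'.+1) <-> (i = i' /\ j = j'))) /\
  (* (c) *)
  (let L := (\sum_(j < k) (alpha j).-1)%N in
   exists X : nat -> Vset F, composition_series h pi d X L /\
   exists phi : nat -> nat * nat,
     (forall r, (r < L)%N -> valid (phi r).1 (phi r).2 /\
        iso_sq h pi (X r) (X r.+1) (W (phi r).1 (phi r).2) (P (phi r).1.+1)) /\
     (forall r s, (r < L)%N -> (s < L)%N -> phi r = phi s -> r = s) /\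
     (forall i j, valid i j -> exists r, (r < L)%N /\ phi r = (i, j))) /\
  (* (d) *)
  ((semisimple h pi d <-> (mh <= 1)%N) /\
   ((mh <= 1)%N <-> ~ exists q : {poly F}, (1 < size q)%N /\ q ^+ 3 %| h)).

Proof.
move=> char0 k0 kt umi uinj a2 a1 h pi d pik mh P W valid eidem nuD.
split.
  split; first exact: (theta0 alpha kt umi uinj).
  split; first by rewrite -(theta_max char0 kt umi uinj a2 a1).
  split=> i im; first exact: (theta_submodule char0 kt umi uinj a2 a1).
  exact: (theta_strict char0 kt umi uinj a2 a1 eidem im).
split.
  move=> i im.
  split; first by move=> g n p; exact: (rho_theta_nil char0 kt umi uinj a2 a1).
  split.
    move=> j /and3P[_ jk ij].
    have [subW [_ [_ [_ _]]]] :=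
      layer_irreducible char0 kt umi uinj a2 a1 eidem jk ij.
    split=> // p; rewrite /W (Wsq_powdiv kt umi uinj eidem jk ij) => Wp l.
    apply/(upowP kt umi uinj (fun q => minn (alpha q).-1 i)) => q qk.
    have /(upowP kt umi uinj)/(_ q qk) := Wp l.
    by apply: dvdp_trans; apply: dvdp_exp2l; case: eqP; lia.
  split; first by move=> p; exact: (layer_sum kt umi uinj eidem).
  split.
    move=> ws Wws Psum j /and3P[_ jk ij].
    apply: (layer_direct kt umi uinj eidem _ Psum jk ij) => r rk ir.
    by apply: Wws; rewrite /valid im rk.
  move=> j /and3P[_ jk ij] mu.
  split; first exact: (layer_irreducible char0 kt umi uinj a2 a1 eidem).
  split; first by move=> q; exact: (layer_coords kt umi uinj a2 eidem).
  move=> q g f n l qk.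
  (* The subtraction alpha_j - i is taken in the naturals here and in the field in [weight]; they
     agree since i <= alpha_j. *)
  have -> : mu = weight F (alpha j) i by rewrite /mu natrB //; lia.
  exact: (layer_action char0 kt umi uinj a2 a1 eidem).
split.
  move=> i j i' j' /and3P[_ jk ij] /and3P[_ jk' ij'].
  exact: (iso_sq_layer char0 kt umi uinj a2 a1 eidem).
split; first exact: (composition_chain char0 kt umi uinj a2 a1 eidem).
split; last exact: (max_le1P kt umi uinj a1).
split; first exact: (semisimple_max_le1 char0 kt umi uinj a2 a1).
exact: (semisimple_of_max_le1 char0 kt umi uinj a2 a1 eidem).
Qed.
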